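(* (i) The joint spectral radius $\Psi\mapsto\mu(\Psi)$ is locally Lipschitz continuous (with respect to the Hausdorff metric) on the set $$\overline{\beta}:=\{\Psi\subset\mathbb{R}^{n\times n}_+\mid \Psi \text{ is compact (and nonempty)},\ \mu(\Psi)>0\}.$$ (ii) The joint spectral radius is Hoelder continuous on the space of (nonempty) compact subsets of $\mathbb{R}^{n\times n}_+$ endowed with the Hausdorff metric.
   Context: $\mathbb{R}^{n\times n}_+$ is the set of $n\times n$ matrices with nonnegative real entries. Max-algebraic matrix product: $(A\otimes B)_{ij}=\max_k a_{ik}b_{kj}$. For $A\in\mathbb{R}^{n\times n}_+$, $\mu(A)=\max\{(a_{i_1i_2}a_{i_2i_3}\cdots a_{i_ki_1})^{1/k} \mid k\ge 1,\ 1\le i_1,\dots,i_k\le n \text{ distinct}\}$. For a bounded set $\Psi\subseteq\mathbb{R}^{n\times n}_+$ and $m\ge1$, $\Psi^m_\otimes=\{A_1\otimes\cdots\otimes A_m\mid A_j\in\Psi\}$, and the max-algebraic joint spectral radius is $\mu(\Psi)=\limsup_{m\to\infty}\left(\sup_{A\in\Psi^m_\otimes}\mu(A)\right)^{1/m}$. The Hausdorff metric is $\mathcal{H}(\Psi,\Phi)=\max\{\max_{A\in\Psi}\mathrm{dist}(A,\Phi),\ \max_{B\in\Phi}\mathrm{dist}(B,\Psi)\}$ with $\mathrm{dist}(A,\Phi)=\min_{B\in\Phi}\|A-B\|$, where $\|\cdot\|$ is the (conventional) matrix norm induced by the norm $\|\cdot\|_\infty$ on $\mathbb{R}^n$. A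 map $f:X\to\mathbb{R}$ on a metric space $(X,d)$ is called Hoelder continuous (of order $\alpha>0$) if there exists a constant $C\ge0$ such that $|f(x)-f(y)|\le C\,d(x,y)^\alpha$ for all $x,y\in X$. It is called locally Lipschitz continuous if for every $z\in X$ there exist $\epsilon>0$ and $C\ge0$ such that $|f(x)-f(y)|\le C\,d(x,y)$ for all $x,y$ in the ball $B_\epsilon(z)$. In (ii) the order $\alpha>0$ is not specified.
   Formalization: Part (ii) with one constant for all compact subsets fails for n ≥ 2 ({[[0,t],[1/t,0]]} and {[[0,t],[0,0]]}, t→∞); it is stated on every ball of any centre and radius, with one order for all balls and the constant depending on the ball (also for the trivial n = 1). *)

(* Defs.v *)
From HB Require Import structures.
From mathcomp Require Import all_boot all_order all_algebra.
From mathcomp Require Import all_classical all_reals all_analysis.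
Import Order.TTheory GRing.Theory Num.Theory.
Import numFieldNormedType.Exports.

Set Implicit Arguments.
Unset Strict Implicit.
Unset Printing Implicit Defensive.

Local Open Scope classical_set_scope.
Local Open Scope ring_scope.

Section MaxAlgebra.
Variables (R : realType) (n : nat).
Implicit Types (A B : 'M[R]_n) (Psi Phi : set 'M[R]_n).

Definition nonneg_mx A : Prop := forall i j, 0 <= A i j.

(* The neutral element 0 of the maxima here and in [max_cycle_mean] is harmless
   because these operations are only used on nonnegative matrices. *)
Definition maxmulmx A B : 'M[R]_n :=
  \matrix_(i, j) \big[Num.max/0]_(k < n) (A i k * B k j).

(* The cycle i_1 -> ... -> i_k -> i_1 of length k = l.+1 is the duplicate-free
   tuple [t], [ordS] being the cyclic successor on its positions; a cycle with
   distinct vertices has length at most n, hence the range of [l]. *)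
Definition max_cycle_mean A : R :=
  \big[Num.max/0]_(l < n) \big[Num.max/0]_(t : l.+1.-tuple 'I_n | uniq t)
    (\prod_(j < l.+1) A (tnth t j) (tnth t (ordS j))) `^ (l.+1%:R^-1).

(* [1%:M] is also the identity of the max-algebraic product, so that for m >= 1
   the iterated product is A_1 (x) ... (x) A_m. *)
Definition max_products Psi (m : nat) : set 'M[R]_n :=
  [set \big[maxmulmx/1%:M]_(j < m) A j
    | A in [set A : 'I_m -> 'M[R]_n | forall j, Psi (A j)]].

Definition max_jsr Psi : R :=
  limn_sup (fun m => sup [set max_cycle_mean A | A in max_products Psi m]
                       `^ (m%:R^-1)).

(* The norm on column vectors is the library's, i.e. the maximum norm. *)
Definition opnorm_infty A : R :=
  sup [set `|A *m x| | x in [set x : 'cV[R]_n | `|x| <= 1]].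

Definition mxdist A Phi : R := inf [set opnorm_infty (A - B) | B in Phi].

Definition hausdorff_dist Psi Phi : R :=
  Num.max (sup [set mxdist A Phi | A in Psi]) (sup [set mxdist B Psi | B in Phi]).

Definition compact_nonneg : set (set 'M[R]_n) :=
  [set Psi | [/\ compact Psi, Psi !=set0 & forall A, Psi A -> nonneg_mx A]].

End MaxAlgebra.

Section Continuity.
Variables (R : realType) (T : Type) (X : set T) (d : T -> T -> R) (f : T -> R).

Definition hoelder_on (alpha : R) : Prop :=
  exists C : R, 0 <= C /\
    forall x y, X x -> X y -> `|f x - f y| <= C * d x y `^ alpha.

Definition locally_lipschitz_on : Prop :=
  forall z, X z -> exists eps C : R, [/\ 0 < eps, 0 <= C &
    forall x y, X x -> X y -> d z x < eps -> d z y < eps ->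
      `|f x - f y| <= C * d x y].

End Continuity.

(* Main.v *)
(* In max algebra the joint spectral radius of Psi is the maximal cycle mean of
   the entrywise maximum S of Psi, and S is 1-Lipschitz in the Hausdorff metric.
   The k-th power of a cycle mean is a product of k <= n entries, hence Lipschitz
   on bounded sets: a^k <= b^k + C d for the two radii a, b at distance d. Since
   (a - b)^k <= a^k - b^k this gives Hoelder continuity of order 1/n, and since
   (a - b) a^(k-1) <= a^k - b^k it gives Lipschitz continuity away from 0. *)

Require Import Defs.
From mathcomp Require Import all_boot all_order all_algebra.
From mathcomp Require Import all_classical all_reals all_analysis.
From mathcomp Require Import ring lra.
Import Order.TTheory GRing.Theory Num.Theory.
Import numFieldNormedType.Exports.
Local Open Scope classical_set_scope.
Local Open Scope ring_scope.

(** * Weighted walks, cycle means and max-algebraic products *)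

Section Walks.
Context {R : realType} {n : nat}.
Implicit Types (A B S : 'M[R]_n) (x y : 'I_n) (p q : seq 'I_n).

(** The list [p] omits the start [x]: a closed walk satisfies [last x p = x], its length is
    [size p], and walks are joined by plain [++]. *)
Fixpoint walk_weight A x p : R :=
  if p is y :: q then A x y * walk_weight A y q else 1.

Lemma walk_weight_cat A x p q :
  walk_weight A x (p ++ q) = walk_weight A x p * walk_weight A (last x p) q.
Proof. by elim: p x => [|y p IHp] x /=; rewrite ?mul1r// IHp mulrA. Qed.

Lemma walk_weight_ge0 A x p : nonneg_mx A -> 0 <= walk_weight A x p.
Proof. by move=> A0; elim: p x => [|y p IHp] x //=; rewrite mulr_ge0. Qed.

Lemma walk_weight_prod A x p m : size p = m ->
  walk_weight A x p = \prod_(j < m) A (nth x (x :: p) j) (nth x p j).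
Proof.
move=> <- {m}; elim: p x => [|y p IHp] x /=; first by rewrite big_ord0.
rewrite big_ord_recl /= IHp; congr (_ * _); apply: eq_bigr => j _.
by congr (A _ _) => /=; apply: set_nth_default => //=; rewrite ltnS ltnW.
Qed.

Lemma cycle_prodE A l (t : l.+1.-tuple 'I_n) :
  \prod_(j < l.+1) A (tnth t j) (tnth t (ordS j)) =
  walk_weight A (thead t) (rcons (behead t) (thead t)).
Proof.
case/tupleP: t => x t; rewrite theadE /= (@walk_weight_prod _ _ _ l.+1)
  ?size_rcons ?size_tuple//.
apply: eq_bigr => j _; rewrite !(tnth_nth x) /=; congr (A _ _).
  case: j => [[|j] lt_j] //=; rewrite nth_rcons size_tuple.
  by rewrite ltnS in lt_j; rewrite lt_j.
(* At the last position [ordS] wraps around to the head, which the walk carries as its appended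
   final vertex. *)
have := ltn_ord j; rewrite ltnS leq_eqVlt.
case/predU1P => [->|lt_j]; first by rewrite modnn nth_rcons size_tuple ltnn eqxx.
by rewrite modn_small ?ltnS//= nth_rcons size_tuple lt_j.
Qed.

Lemma max_cycle_mean_ge0 A : 0 <= max_cycle_mean A.
Proof. exact: bigmax_ge_id. Qed.

Lemma simple_cycle_weight_le A x p : nonneg_mx A -> last x p = x ->
  uniq p -> (0 < size p)%N -> walk_weight A x p <= max_cycle_mean A ^+ size p.
Proof.
move=> A0; case/lastP: p => // q z; rewrite last_rcons => ->.
rewrite rcons_uniq size_rcons => /andP[xq uq] _.
(* Moving the final [x] to the front turns the walk into a tuple indexing this cycle in
   [max_cycle_mean]. *)
have u : uniq (in_tuple (x :: q)) by rewrite /= xq.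
have lt_q : (size q < n)%N.
  by move/card_uniqP: u => /= <-; rewrite -[leqRHS]card_ord max_card.
have wE := @cycle_prodE A _ (in_tuple (x :: q)).
rewrite /thead (tnth_nth x) /= in wE.
have w0 := @walk_weight_ge0 A x (rcons q x) A0.
suff w_le : walk_weight A x (rcons q x) `^ (size q).+1%:R^-1 <= max_cycle_mean A.
  rewrite -(ler_pXn2r (ltn0Sn (size q))) ?nnegrE ?powR_ge0// in w_le.
    by rewrite -powR_mulrn ?powR_ge0// -powRrM mulVf ?powRr1 // in w_le.
  exact: max_cycle_mean_ge0.
rewrite /max_cycle_mean; apply: (bigmax_sup (Ordinal lt_q)) => //=.
by apply: (bigmax_sup (in_tuple (x :: q))) => //=; rewrite wE.
Qed.

(* A closed walk with a repeated vertex splits into two shorter closed walks. *)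
Lemma closed_walk_weight_le A x p : nonneg_mx A -> last x p = x ->
  walk_weight A x p <= max_cycle_mean A ^+ size p.
Proof.
move=> A0; have [m] := ubnP (size p); elim: m => // m IHm in x p *.
rewrite ltnS => le_pm px; have mu0 := max_cycle_mean_ge0 A.
have [up|] := boolP (uniq p).
  case: (posnP (size p)) => [/size0nil -> /=|p0]; first by rewrite expr0.
  exact: simple_cycle_weight_le.
move=> /(uniqPn x) [i [j [lt_ij lt_jp eq_ij]]].
set y := nth x p i in eq_ij.
have lt_ip := ltn_trans lt_ij lt_jp.
(* Both positions carry [y], so [rcons p2 y] is closed at [y]; cutting it out leaves
   [rcons p1 y ++ p3], closed at [x]. *)
pose p1 := take i p; pose p2 := take (j - i.+1) (drop i.+1 p).
pose p3 := drop j.+1 p.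
have pE : p = rcons p1 y ++ rcons p2 y ++ p3.
  rewrite -take_nth // -{1}(cat_take_drop i.+1 p); congr (_ ++ _).
  rewrite -{1}(cat_take_drop (j - i.+1) (drop i.+1 p)) cat_rcons; congr (_ ++ _).
  by rewrite drop_drop subnK // (drop_nth x lt_jp) -eq_ij.
clearbody p1 p2 p3 y; move: pE => pE; clear eq_ij; subst p.
rewrite !walk_weight_cat !last_rcons mulrCA.
rewrite !size_cat !size_rcons in le_pm *.
rewrite !last_cat !last_rcons in px.
rewrite addnCA exprD; apply: ler_pM; rewrite ?mulr_ge0 ?walk_weight_ge0//.
  rewrite -(size_rcons p2 y); apply: IHm; rewrite ?last_rcons ?size_rcons//.
  by apply: leq_trans le_pm; rewrite addSn ltnS addnCA leq_addr.
have := IHm x (rcons p1 y ++ p3).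
rewrite walk_weight_cat last_cat last_rcons size_cat size_rcons.
apply => //; apply: leq_trans le_pm.
by rewrite ltn_add2l addSn ltnS leq_addl.
Qed.

(** A maximum over finitely many cycles is reached by one of them, unless it is the neutral element
    0. *)
Lemma max_cycle_mean_attained A : nonneg_mx A ->
  max_cycle_mean A = 0 \/ exists x p,
    [/\ last x p = x, (0 < size p <= n)%N &
        max_cycle_mean A ^+ size p <= walk_weight A x p].
Proof.
move=> A0; have mu0 := max_cycle_mean_ge0 A.
have /bigmax_geP[mu_le|[l _ /bigmax_geP[mu_le|[t ut]]]] :=
  lexx (max_cycle_mean A).
- by left; apply/le_anti; rewrite mu_le mu0.
- by left; apply/le_anti; rewrite mu_le mu0.
rewrite -/(max_cycle_mean A) cycle_prodE => mu_le; right.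
exists (thead t), (rcons (behead t) (thead t)).
rewrite last_rcons size_rcons size_behead size_tuple /=; split => //.
rewrite -(ler_pXn2r (ltn0Sn l)) ?nnegrE ?powR_ge0// in mu_le.
by rewrite -[X in _ <= X]powR_mulrn ?powR_ge0// -powRrM mulVf
           ?powRr1 ?walk_weight_ge0// in mu_le.
Qed.

Lemma closed_walk_repeat A x p k : last x p = x ->
  exists p', [/\ last x p' = x, size p' = (k * size p)%N &
    walk_weight A x p' = walk_weight A x p ^+ k].
Proof.
move=> px; elim: k => [|k [p' [lp' sp' wp']]]; first by exists [::].
exists (p ++ p'); split; first by rewrite last_cat px.
  by rewrite size_cat sp' mulSn.
by rewrite walk_weight_cat px wp' exprS.
Qed.

Lemma maxmulmx_nonneg A B : nonneg_mx (maxmulmx A B).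
Proof. by move=> i j; rewrite mxE; exact: bigmax_ge_id. Qed.

Lemma max_products_nonneg m (A : 'I_m -> 'M[R]_n) :
  nonneg_mx (\big[@maxmulmx R n/1%:M]_(j < m) A j).
Proof.
case: m A => [|m] A i j; first by rewrite big_ord0 mxE ler0n.
by rewrite big_ord_recl; exact: maxmulmx_nonneg.
Qed.

(** The intermediate indices at which the successive maxima are reached form the walk; the
    alternative 0 is the neutral element of these maxima, or an off-diagonal entry of the empty
    product. *)
Lemma max_product_walk m (A : 'I_m -> 'M[R]_n) S i j :
  nonneg_mx S -> (forall k x y, 0 <= A k x y <= S x y) ->
  (\big[@maxmulmx R n/1%:M]_(k < m) A k) i j = 0 \/
  exists p, [/\ last i p = j, size p = m &
    (\big[@maxmulmx R n/1%:M]_(k < m) A k) i j <= walk_weight S i p].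
Proof.
move=> S0; elim: m => [|m IHm] in A i * => AS.
  rewrite big_ord0 mxE; case: eqVneq => [->|_]; last by left.
  by right; exists [::].
rewrite big_ord_recl; set B := \big[_/_]_(k < m) _.
have B0 : nonneg_mx B := max_products_nonneg _ _.
have [] := boolP (maxmulmx (A ord0) B i j == 0); first by move/eqP; left.
rewrite mxE => ne0; right.
have /bigmax_geP[le0|[k _ le_k]] :=
  lexx (\big[Num.max/0]_(k < n) (A ord0 i k * B k j)).
  by case/eqP: ne0; apply/le_anti; rewrite le0 bigmax_ge_id.
have [Bkj0|[p [pj sp le_p]]] := IHm (fun k => A (lift ord0 k)) k (fun _ => AS _).
  case/eqP: ne0; apply/le_anti; rewrite bigmax_ge_id andbT.
  by rewrite (le_trans le_k)// /B Bkj0 mulr0.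
exists (k :: p); split => //=; first by rewrite sp.
have /andP[A0 le_AS] := AS ord0 i k.
by rewrite (le_trans le_k)// ler_pM.
Qed.

Lemma max_product_walks m (A : 'I_m -> 'M[R]_n) S x p :
  nonneg_mx S -> (forall k x y, 0 <= A k x y <= S x y) ->
  walk_weight (\big[@maxmulmx R n/1%:M]_(k < m) A k) x p = 0 \/
  exists q, [/\ last x q = last x p, size q = (m * size p)%N &
    walk_weight (\big[@maxmulmx R n/1%:M]_(k < m) A k) x p <= walk_weight S x q].
Proof.
move=> S0 AS; set B := \big[_/_]_(k < m) _.
have B0 : nonneg_mx B := max_products_nonneg _ _.
elim: p x => [|y p IHp] x /=; first by right; exists [::]; rewrite muln0.
have [->|[q1 [lq1 sq1 wq1]]] := @max_product_walk _ _ _ x y S0 AS.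
  by left; rewrite mul0r.
have [->|[q2 [lq2 sq2 wq2]]] := IHp y; first by left; rewrite mulr0.
right; exists (q1 ++ q2); split; first by rewrite last_cat lq1.
  by rewrite size_cat sq1 sq2 mulnS.
by rewrite walk_weight_cat lq1 ler_pM ?walk_weight_ge0.
Qed.

Lemma max_cycle_mean_product_le m (A : 'I_m -> 'M[R]_n) S :
  nonneg_mx S -> (forall k x y, 0 <= A k x y <= S x y) ->
  max_cycle_mean (\big[@maxmulmx R n/1%:M]_(k < m) A k) <= max_cycle_mean S ^+ m.
Proof.
move=> S0 AS; set B := \big[_/_]_(k < m) _.
have B0 : nonneg_mx B := max_products_nonneg _ _.
have muS0 := max_cycle_mean_ge0 S; have muB0 := max_cycle_mean_ge0 B.
have [->|[x [p [px /andP[p0 _] le_p]]]] := @max_cycle_mean_attained B B0.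
  exact: exprn_ge0.
rewrite -(ler_pXn2r p0) ?nnegrE ?exprn_ge0// (le_trans le_p)//.
have [->|[q [qx sq le_q]]] := @max_product_walks _ A S x p S0 AS.
  by rewrite !exprn_ge0.
by rewrite (le_trans le_q)// -exprM -sq closed_walk_weight_le// qx.
Qed.

(** Each factor is chosen to attain the entry of [S] used at its step; the walk then contributes one
    of the terms of the maximum that the product takes. *)
Lemma walk_weight_le_product (Psi : set 'M[R]_n) S x p :
  (forall A, Psi A -> nonneg_mx A) ->
  (forall i j, exists2 A, Psi A & A i j = S i j) ->
  exists2 A : 'I_(size p) -> 'M[R]_n, (forall k, Psi (A k)) &
    walk_weight S x p <=
    (\big[@maxmulmx R n/1%:M]_(k < size p) A k) x (last x p).
Proof.
move=> Psi0 PsiS; elim: p x => [|y p IHp] x /=.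
  by exists (fun=> 0) => [[]//|]; rewrite big_ord0 mxE eqxx.
have [A PsiA le_A] := IHp y; have [A0 PsiA0 A0E] := PsiS x y.
(* This family is [A] with [A0] prepended. *)
exists (fun k => if unlift ord0 k is Some k' then A k' else A0) => [k|].
  by case: unlift.
rewrite big_ord_recl mxE unlift_none (bigmax_sup y)// A0E.
under eq_bigr do rewrite liftK.
by rewrite ler_wpM2l// -A0E Psi0.
Qed.

End Walks.

(** * Reduction of the joint spectral radius to the entrywise maximum *)

Section JointSpectralRadius.
Context {R : realType} {n : nat}.
Implicit Types (S : 'M[R]_n) (Psi : set 'M[R]_n).

Lemma limn_sup_const_frequently (u : R^nat) (l : R) :
  (forall m, (0 < m)%N -> u m <= l) ->
  (forall N, exists2 m, (N <= m)%N & l <= u m) -> limn_sup u = l.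
Proof.
(* All tail suprema from index 1 on equal [l]. Index 0 is left out: there the exponent in [max_jsr]
   is the inverse of 0, which is 0, so the term is 1 and may exceed [l]. *)
move=> u_le le_u; apply: norm_lim_near_cst; exists 1%N => // N /= N0.
have ub : ubound (sdrop u N) l.
  by move=> _ [m /= Nm <-]; apply: u_le; exact: leq_trans Nm.
have [m Nm lm] := le_u N; apply/le_anti/andP; split.
  by apply: ge_sup => //; exists (u m), m.
by apply: (le_trans lm); apply: ub_le_sup; [exists l|exists m].
Qed.

(* For A_1, ..., A_m in Psi, a cycle of the product unfolds to a closed walk m
   times as long in the entrywise maximum S. Conversely, matrices of Psi
   attaining the entries of S along an optimal cycle of S, repeated, give
   products whose diagonal reaches the same mean. *)
Lemma max_jsr_entrywise_max Psi S :
  (forall A, Psi A -> nonneg_mx A) ->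
  (forall i j, exists2 A, Psi A & A i j = S i j) ->
  (forall A, Psi A -> forall i j, A i j <= S i j) ->
  Psi !=set0 -> max_jsr Psi = max_cycle_mean S.
Proof.
move=> Psi0 PsiS PsiSle [A0 PsiA0]; have mu0 := max_cycle_mean_ge0 S.
have S0 : nonneg_mx S by move=> i j; have [A PA <-] := PsiS i j; exact: Psi0.
have ub m : ubound [set max_cycle_mean A | A in max_products Psi m]
    (max_cycle_mean S ^+ m).
  move=> _ [_ [A PsiA <-] <-]; apply: max_cycle_mean_product_le => // k i j.
  by rewrite Psi0 ?PsiSle//; exact: PsiA.
have ne m : [set max_cycle_mean A | A in max_products Psi m] !=set0.
  by eexists; eexists; [exists (fun=> A0)|].
have sup0 m : 0 <= sup [set max_cycle_mean A | A in max_products Psi m].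
  have [v vP] := ne m; apply: (@le_trans _ _ v); last first.
    by apply: ub_le_sup => //; eexists; exact: ub.
  by case: vP => ? _ <-; exact: max_cycle_mean_ge0.
have rootK m (a : R) : (0 < m)%N -> 0 <= a -> (a ^+ m) `^ m%:R^-1 = a.
  by move=> m0 a0; rewrite -powR_mulrn// -powRrM mulfV ?powRr1// pnatr_eq0 -lt0n.
apply: limn_sup_const_frequently => [m m0|N].
  rewrite -[leRHS](rootK m)// ge0_ler_powR ?nnegrE ?invr_ge0 ?ler0n ?exprn_ge0//.
  exact: ge_sup.
have [->|[x [p [px /andP[p0 _] le_p]]]] := @max_cycle_mean_attained _ _ S S0.
  by exists N => //; exact: powR_ge0.
(* Repeating [N.+1] times makes the length, and hence the number of factors, at least [N]. *)
have [q [qx sq wq]] := @closed_walk_repeat _ _ S x p N.+1 px.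
have [A PsiA le_A] := @walk_weight_le_product _ _ Psi S x q Psi0 PsiS.
exists (size q); first by rewrite sq (leq_trans (leqnSn N))// leq_pmulr.
have q0 : (0 < size q)%N by rewrite sq muln_gt0.
rewrite -[leLHS](rootK (size q))//.
rewrite ge0_ler_powR ?nnegrE ?invr_ge0 ?ler0n ?exprn_ge0//.
set B := \big[_/_]_(k < _) _ in le_A.
apply: (@le_trans _ _ (max_cycle_mean B)); last first.
  by apply: ub_le_sup; [eexists; exact: ub|exists B => //; exists A].
(* The diagonal entry [B x x] is the weight of the loop at [x], hence a lower bound for the cycle
   mean of [B]. *)
have := @closed_walk_weight_le _ _ B x [:: x] (max_products_nonneg _ _) erefl.
rewrite /= mulr1 expr1; apply: le_trans; rewrite qx in le_A.
apply: le_trans le_A; rewrite wq sq mulnC exprM.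
by rewrite lerXn2r ?nnegrE ?exprn_ge0 ?walk_weight_ge0.
Qed.

(** Coordinates are continuous, so each attains its maximum on the compact set, in general at
    different matrices; [S] itself need not belong to [Psi]. *)
Lemma entrywise_max_exists Psi : compact_nonneg Psi ->
  exists S, [/\ nonneg_mx S,
    forall i j, exists2 A, Psi A & A i j = S i j &
    forall A, Psi A -> forall i j, A i j <= S i j].
Proof.
move=> [cPsi Psi_neq0 Psi0].
have /choice[f f_max] : forall ij : 'I_n * 'I_n, exists A, Psi A /\
    forall B, Psi B -> B ij.1 ij.2 <= A ij.1 ij.2.
  move=> [i j] /=.
  have [] := @compact_EVT_max _ R (fun A : 'M[R]_n => A i j) _ Psi_neq0 cPsi.
    exact/continuous_subspaceT/coord_continuous.
  move=> A /set_mem PsiA le_A; exists A; split => // B PsiB.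
  exact/le_A/mem_set.
exists (\matrix_(i, j) f (i, j) i j); split=> [i j|i j|A PsiA i j].
- by rewrite mxE; apply: Psi0; have [] := f_max (i, j).
- by exists (f (i, j)); [have [] := f_max (i, j)|rewrite mxE].
- by rewrite mxE; have [_] := f_max (i, j); exact.
Qed.

End JointSpectralRadius.

(** * The operator norm and the Hausdorff distance *)

Section OperatorNorm.
Context {R : realType}.

Lemma mx_entry_le_norm m n (A : 'M[R]_(m, n)) i j : `|A i j| <= `|A|.
Proof.
by rewrite [leRHS]/Num.Def.normr /= mx_normrE; apply: (bigmax_sup (i, j)).
Qed.

Lemma mx_norm_le m n (A : 'M[R]_(m, n)) c : 0 <= c ->
  (forall i j, `|A i j| <= c) -> `|A| <= c.
Proof.
move=> c0 le_c; rewrite [leLHS]/Num.Def.normr /= mx_normrE.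
by apply: bigmax_le => // -[i j] _; exact: le_c.
Qed.

Context {n : nat}.
Implicit Types (A B S T : 'M[R]_n) (Psi Phi Z : set 'M[R]_n).

Lemma opnorm_infty_ubound A :
  ubound [set `|A *m x| | x in [set x : 'cV[R]_n | `|x| <= 1]] (`|A| *+ n).
Proof.
move=> _ [x /= x1 <-]; apply: mx_norm_le => [|i j]; first exact: mulrn_wge0.
rewrite mxE (le_trans (ler_norm_sum _ _ _))//.
have -> : `|A| *+ n = \sum_(k < n) `|A| by rewrite sumr_const card_ord.
apply: ler_sum => k _.
by rewrite normrM -[leRHS]mulr1 ler_pM ?mx_entry_le_norm//
           (le_trans (mx_entry_le_norm _ _ _ _ _)).
Qed.

Lemma opnorm_infty_le A : opnorm_infty A <= `|A| *+ n.
Proof.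
apply: ge_sup; last exact: opnorm_infty_ubound.
by exists `|A *m (0 : 'cV[R]_n)|, 0 => //=; rewrite normr0.
Qed.

(** The unit vector [delta_mx j 0] has norm at most 1 and is mapped to column [j]. *)
Lemma entry_le_opnorm_infty A i j : `|A i j| <= opnorm_infty A.
Proof.
have d1 : `|delta_mx j 0 : 'cV[R]_n| <= 1.
  apply: mx_norm_le => // k l; rewrite mxE.
  by case: (_ && _); rewrite ?normr1 ?normr0.
apply: (@le_trans _ _ `|A *m (delta_mx j 0 : 'cV[R]_n)|).
  by rewrite -colE (le_trans _ (mx_entry_le_norm _ _ _ i 0))// mxE.
apply: ub_le_sup; last by exists (delta_mx j 0).
by eexists; exact: opnorm_infty_ubound.
Qed.

Lemma opnorm_infty_ge0 A : 0 <= opnorm_infty A.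
Proof.
apply: (@le_trans _ _ `|A *m (0 : 'cV[R]_n)|) => //.
apply: ub_le_sup; last by exists 0 => //=; rewrite normr0.
by eexists; exact: opnorm_infty_ubound.
Qed.

Lemma mxdist_lbound A Phi : lbound [set opnorm_infty (A - B) | B in Phi] 0.
Proof. by move=> _ [B _ <-]; exact: opnorm_infty_ge0. Qed.

Lemma hausdorff_distC Psi Phi : hausdorff_dist Psi Phi = hausdorff_dist Phi Psi.
Proof. exact: maxC. Qed.

Lemma mxdist_le_hausdorff Psi Phi A : compact_nonneg Psi -> compact_nonneg Phi ->
  Psi A -> mxdist A Phi <= hausdorff_dist Psi Phi.
Proof.
move=> PsiP PhiP PsiA.
have [S [_ _ leS]] := @entrywise_max_exists _ _ _ PsiP.
have [_ [B PhiB] _] := PhiP; have [_ _ Psi0] := PsiP.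
apply: (@le_trans _ _ (sup [set mxdist A Phi | A in Psi])); last first.
  by rewrite le_max lexx.
apply: ub_le_sup; last by exists A.
(* The supremum is meaningful only over a bounded set; the distances to one fixed [B] are bounded
   because [S] dominates all of [Psi]. *)
exists ((`|S| + `|B|) *+ n) => _ [C PsiC <-].
apply: (@le_trans _ _ (opnorm_infty (C - B))).
  by apply: ge_inf; [exists 0; exact: mxdist_lbound|exists B].
rewrite (le_trans (opnorm_infty_le _))// lerMn2r; apply/orP; right.
rewrite (le_trans (ler_normB _ _))// lerD2r; apply: mx_norm_le => // i j.
rewrite ger0_norm ?Psi0// (le_trans (leS _ PsiC i j))//.
by rewrite (le_trans (ler_norm _))// mx_entry_le_norm.
Qed.

Lemma hausdorff_dist_ge0 Psi Phi : compact_nonneg Psi -> compact_nonneg Phi ->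
  0 <= hausdorff_dist Psi Phi.
Proof.
move=> PsiP PhiP; have [_ [A PsiA] _] := PsiP; have [_ [B PhiB] _] := PhiP.
apply: (le_trans _ (mxdist_le_hausdorff _ _ _ PsiP PhiP PsiA)).
by apply: lb_le_inf; [exists (opnorm_infty (A - B)), B|exact: mxdist_lbound].
Qed.

Lemma hausdorff_dist_refl Psi : compact_nonneg Psi -> hausdorff_dist Psi Psi = 0.
Proof.
move=> PsiP; apply/le_anti; rewrite hausdorff_dist_ge0// andbT.
have [_ [A PsiA] _] := PsiP; rewrite /hausdorff_dist maxxx.
apply: ge_sup => [|_ [B PsiB <-]]; first by exists (mxdist A Psi), A.
apply: (@le_trans _ _ (opnorm_infty (B - B))).
  by apply: ge_inf; [exists 0; exact: mxdist_lbound|exists B].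
by rewrite (le_trans (opnorm_infty_le _))// subrr normr0 mul0rn.
Qed.

(** A matrix of [Psi] attaining the entry has, up to any [e > 0], a matrix of [Phi] within the
    Hausdorff distance, and entries differ by at most the operator norm. *)
Lemma entrywise_max_le_hausdorff Psi Phi S T :
  compact_nonneg Psi -> compact_nonneg Phi ->
  (forall i j, exists2 A, Psi A & A i j = S i j) ->
  (forall A, Phi A -> forall i j, A i j <= T i j) ->
  forall i j, S i j <= T i j + hausdorff_dist Psi Phi.
Proof.
move=> PsiP PhiP PsiS leT i j; have [A PsiA <-] := PsiS i j.
apply/ler_addgt0Pr => e e0; have [_ [B0 PhiB0] _] := PhiP.
have hinf : has_inf [set opnorm_infty (A - B) | B in Phi].
  split; first by exists (opnorm_infty (A - B0)), B0.
  by exists 0; exact: mxdist_lbound.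
have [_ [B PhiB <-] ltB] := inf_adherent e0 hinf.
have := mxdist_le_hausdorff _ _ _ PsiP PhiP PsiA; rewrite /mxdist => le_H.
have := le_trans (ler_norm _) (entry_le_opnorm_infty (A - B) i j).
rewrite !mxE => le_AB; have := leT _ PhiB i j; lra.
Qed.

End OperatorNorm.

(** * Elementary inequalities between powers *)

Lemma exprD_superadditive {R : realDomainType} (x y : R) k :
  0 <= x -> 0 <= y -> (0 < k)%N -> x ^+ k + y ^+ k <= (x + y) ^+ k.
Proof.
move=> x0 y0; elim: k => // -[|k] IHk _; first by rewrite !expr1.
rewrite exprS [in leRHS]exprS (exprS y).
apply: le_trans (ler_wpM2l (addr_ge0 x0 y0) (IHk isT)).
rewrite mulrDl !mulrDr -addrA lerD2l addrA lerDr.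
by rewrite addr_ge0 ?mulr_ge0 ?exprn_ge0.
Qed.

Section PowerInequalities.
Context {R : realFieldType}.
Implicit Types (a b c e x M : R).

(** Here [e] is the [n]-th root of the error. If [e < 1], then [e ^+ n <= e ^+ k] makes the bound
    independent of [k]; if [e >= 1], then [a - b <= M <= M * e] already. *)
Lemma sub_le_of_expr_le a b e M k n : 0 <= b -> 0 <= e -> 1 <= M -> a <= M ->
  (0 < k <= n)%N -> a ^+ k <= b ^+ k + e ^+ n -> a - b <= M * e.
Proof.
move=> b0 e0 M1 aM /andP[k0 kn] le_k; have M0 : 0 <= M by lra.
have [e1|e1] := leP 1 e.
  by apply: (@le_trans _ _ M); [lra|rewrite ler_peMr].
have [ab|ab] := leP a b; first by rewrite (@le_trans _ _ 0) ?subr_le0// mulr_ge0.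
apply: (@le_trans _ _ e); last by rewrite ler_peMl.
have ab0 : 0 <= a - b by rewrite subr_ge0 ltW.
rewrite -(ler_pXn2r k0) ?nnegrE//.
apply: (@le_trans _ _ (e ^+ n)); last by rewrite ler_wiXn2l// ltW.
apply: (@le_trans _ _ (a ^+ k - b ^+ k)); last by rewrite lerBlDl.
by rewrite lerBrDr; have := exprD_superadditive _ _ _ ab0 b0 k0; rewrite subrK.
Qed.

Lemma sub_le_of_expr_le_away0 a b c x k n : 0 <= b -> 0 < c -> c <= 1 ->
  c <= a -> 0 <= x -> (0 < k <= n)%N -> a ^+ k <= b ^+ k + x ->
  a - b <= x / c ^+ n.
Proof.
move=> b0 c0 c1 ca x0 /andP[k0 kn] le_k.
have cn0 : 0 < c ^+ n by rewrite exprn_gt0.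
have [ab|ab] := leP a b.
  by rewrite (@le_trans _ _ 0) ?subr_le0// divr_ge0// ltW.
rewrite ler_pdivlMr//; apply: (@le_trans _ _ ((a - b) * a ^+ k.-1)).
  rewrite ler_wpM2l ?subr_ge0 ?(ltW ab)//.
  (* As [c <= 1], the unknown exponent [k.-1] may be raised to [n]. *)
  apply: (@le_trans _ _ (c ^+ k.-1)).
    by apply: ler_wiXn2l; rewrite ?(ltW c0)// (leq_trans (leq_pred k)).
  by rewrite lerXn2r ?nnegrE ?(ltW c0) ?(le_trans (ltW c0)).
case: k k0 kn le_k => // k _ _; rewrite !exprS /= => le_k.
have bk : b ^+ k <= a ^+ k.
  by rewrite lerXn2r ?nnegrE ?(ltW ab) ?(le_trans b0 (ltW ab)).
have := ler_wpM2l b0 bk; lra.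
Qed.

(** This keeps the radius away from 0 near a set of positive radius. If [b < c], then [2 * c ^+ k <=
    (2 * c) ^+ k <= a ^+ k <= b ^+ k + x < 2 * c ^+ k]. *)
Lemma le_of_expr_le a b c x k n : 0 <= b -> 0 < c -> c <= 1 -> 2 * c <= a ->
  (0 < k <= n)%N -> a ^+ k <= b ^+ k + x -> x < c ^+ n -> c <= b.
Proof.
move=> b0 c0 c1 ca /andP[k0 kn] le_k ltx; rewrite leNgt; apply/negP => lt_bc.
have : b ^+ k <= c ^+ k by rewrite lerXn2r ?nnegrE// ltW.
have : (2 * c) ^+ k <= a ^+ k by rewrite lerXn2r ?nnegrE//; lra.
have : c ^+ k + c ^+ k <= (c + c) ^+ k.
  by apply: exprD_superadditive => //; exact: ltW.
have : c ^+ n <= c ^+ k by rewrite ler_wiXn2l// ltW.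
have -> : 2 * c = c + c by ring.
lra.
Qed.

End PowerInequalities.

(** * Perturbation of the radius and the two continuity statements *)

Section Perturbation.
Context {R : realType} {n : nat}.
Implicit Types (S T : 'M[R]_n) (Psi Phi Z : set 'M[R]_n).

Lemma walk_weight_le S x p M : nonneg_mx S -> (forall i j, S i j <= M) ->
  walk_weight S x p <= M ^+ size p.
Proof.
move=> S0 SM; elim: p x => [|y p IHp] x //=.
by rewrite exprS ler_pM ?walk_weight_ge0.
Qed.

Lemma max_cycle_mean_le S M : 0 <= M -> nonneg_mx S ->
  (forall i j, S i j <= M) -> max_cycle_mean S <= M.
Proof.
move=> M0 S0 SM.
have [->//|[x [p [_ /andP[p0 _] le_p]]]] := max_cycle_mean_attained S S0.
rewrite -(ler_pXn2r p0) ?nnegrE ?max_cycle_mean_ge0//.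
by rewrite (le_trans le_p)// walk_weight_le.
Qed.

(** Factors are exchanged one at a time; each exchange costs [d] times a product of the remaining
    factors, all at most [M], and [1 <= M] pays for the spare power. *)
Lemma walk_weight_perturb S T x p M d : 1 <= M -> 0 <= d ->
  nonneg_mx S -> nonneg_mx T -> (forall i j, S i j <= M) ->
  (forall i j, T i j <= M) -> (forall i j, S i j <= T i j + d) ->
  walk_weight S x p <= walk_weight T x p + (size p)%:R * M ^+ size p * d.
Proof.
move=> M1 d0 S0 T0 SM TM ST; have M0 : 0 <= M by lra.
elim: p x => [|y p IHp] x /=; first by rewrite !mul0r addr0.
have w0 := @walk_weight_ge0 _ _ S y p S0.
apply: (@le_trans _ _ (T x y * walk_weight S y p + d * M ^+ size p)).
  apply: (@le_trans _ _ ((T x y + d) * walk_weight S y p)).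
    by rewrite ler_wpM2r.
  by rewrite mulrDl lerD2l ler_wpM2l// walk_weight_le.
apply: (@le_trans _ _ (T x y * walk_weight T y p +
    (M * ((size p)%:R * M ^+ size p * d) + M * (d * M ^+ size p)))).
  rewrite addrA lerD//.
    apply: (le_trans (ler_wpM2l (T0 x y) (IHp y))).
    by rewrite mulrDr lerD2l ler_wpM2r// !mulr_ge0 ?exprn_ge0.
  by rewrite ler_peMl// mulr_ge0// exprn_ge0.
by rewrite lerD2l exprS -natr1 le_eqVlt; apply/orP; left; apply/eqP; ring.
Qed.

(** The exponent [k] is the length of an optimal cycle of [S], whose weight in [T] is at most the
    [k]-th power of the mean of [T]. *)
Lemma max_cycle_mean_perturb S T M d : (0 < n)%N -> 1 <= M -> 0 <= d ->
  nonneg_mx S -> nonneg_mx T -> (forall i j, S i j <= M) ->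
  (forall i j, T i j <= M) -> (forall i j, S i j <= T i j + d) ->
  exists2 k, (0 < k <= n)%N &
    max_cycle_mean S ^+ k <= max_cycle_mean T ^+ k + n%:R * M ^+ n * d.
Proof.
move=> n0 M1 d0 S0 T0 SM TM ST; have M0 : 0 <= M by lra.
have [->|[x [p [px /andP[p0 pn] le_p]]]] := max_cycle_mean_attained S S0.
  by exists 1%N => //; rewrite !expr1 addr_ge0 ?max_cycle_mean_ge0 ?mulr_ge0 ?exprn_ge0.
exists (size p); first by rewrite p0.
apply: (le_trans le_p).
apply: (le_trans (walk_weight_perturb _ _ _ _ _ _ M1 d0 S0 T0 SM TM ST)).
apply: lerD; first exact: closed_walk_weight_le.
by rewrite ler_wpM2r// ler_pM ?exprn_ge0// ?ler_nat// ler_weXn2l.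
Qed.

Lemma max_jsr_ge0 Psi : compact_nonneg Psi -> 0 <= max_jsr Psi.
Proof.
move=> PsiP; have [S [S0 PsiS leS]] := entrywise_max_exists _ PsiP.
have [_ ne Psi0] := PsiP.
by rewrite (@max_jsr_entrywise_max _ _ Psi S)// max_cycle_mean_ge0.
Qed.

Lemma max_jsr_perturb Z r : (0 < n)%N -> compact_nonneg Z ->
  exists2 M : R, 1 <= M & forall Psi Phi,
    compact_nonneg Psi -> compact_nonneg Phi ->
    hausdorff_dist Z Psi < r -> hausdorff_dist Z Phi < r ->
    max_jsr Psi <= M /\ exists2 k, (0 < k <= n)%N &
      max_jsr Psi ^+ k <= max_jsr Phi ^+ k + n%:R * M ^+ n * hausdorff_dist Psi Phi.
Proof.
move=> n0 ZP; have [Sz [_ _ leSz]] := entrywise_max_exists _ ZP.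
(* Entries of sets within [r] of [Z] exceed those of [Sz] by at most [r]; the 1 secures [1 <= M].
   The constant depends only on [Z] and [r]. *)
exists (1 + `|Sz| + `|r|) => [|Psi Phi PsiP PhiP rPsi rPhi].
  by rewrite -addrA lerDl addr_ge0.
set M := 1 + _ + _; have M1 : 1 <= M by rewrite /M -addrA lerDl addr_ge0.
have bound Xi S : compact_nonneg Xi -> hausdorff_dist Z Xi < r ->
    (forall i j, exists2 A, Xi A & A i j = S i j) -> forall i j, S i j <= M.
  move=> XiP rXi XiS i j.
  have := entrywise_max_le_hausdorff _ _ _ _ XiP ZP XiS leSz i j.
  rewrite hausdorff_distC.
  have := le_trans (ler_norm _) (mx_entry_le_norm _ _ Sz i j).
  have := ler_norm r; rewrite /M; lra.
have [S [S0 PsiS leS]] := entrywise_max_exists _ PsiP.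
have [T [T0 PhiT leT]] := entrywise_max_exists _ PhiP.
have [_ neS Psi0] := PsiP; have [_ neT Phi0] := PhiP.
rewrite (@max_jsr_entrywise_max _ _ Psi S)// (@max_jsr_entrywise_max _ _ Phi T)//.
have SM := bound _ _ PsiP rPsi PsiS; have TM := bound _ _ PhiP rPhi PhiT.
split; first by apply: max_cycle_mean_le => //; lra.
apply: max_cycle_mean_perturb => //; first exact: hausdorff_dist_ge0.
exact: entrywise_max_le_hausdorff.
Qed.

Lemma max_jsr_hoelder Z r : (0 < n)%N -> compact_nonneg Z ->
  hoelder_on [set Psi : set 'M[R]_n |
      compact_nonneg Psi /\ hausdorff_dist Z Psi < r]
    (@hausdorff_dist R n) (@max_jsr R n) n%:R^-1.
Proof.
move=> n0 ZP; have [M M1 HM] := max_jsr_perturb Z r n0 ZP.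
pose L := n%:R * M ^+ n; have M0 : 0 <= M by lra.
have L0 : 0 <= L by rewrite mulr_ge0 ?exprn_ge0.
exists (M * L `^ n%:R^-1); split; first by rewrite mulr_ge0 ?powR_ge0.
suff le_e Psi Phi : compact_nonneg Psi -> compact_nonneg Phi ->
    hausdorff_dist Z Psi < r -> hausdorff_dist Z Phi < r ->
    max_jsr Psi - max_jsr Phi <=
    M * L `^ n%:R^-1 * hausdorff_dist Psi Phi `^ n%:R^-1.
  move=> Psi Phi [PsiP rPsi] [PhiP rPhi]; rewrite ler_norml le_e// andbT.
  by rewrite lerNl opprB hausdorff_distC le_e.
move=> PsiP PhiP rPsi rPhi; have [aM [k kn le_k]] := HM _ _ PsiP PhiP rPsi rPhi.
have H0 := hausdorff_dist_ge0 _ _ PsiP PhiP.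
(* [e] is the [n]-th root of the additive error [L * hausdorff_dist Psi Phi]. *)
rewrite -mulrA -powRM//; set e := _ `^ _.
have eE : e ^+ n = L * hausdorff_dist Psi Phi.
  have nR0 : n%:R != 0 :> R by rewrite pnatr_eq0 -lt0n.
  by rewrite -powR_mulrn ?powR_ge0// -powRrM mulVf// powRr1// mulr_ge0.
have e0 : 0 <= e := powR_ge0 _ _; rewrite -/L -eE in le_k.
exact: sub_le_of_expr_le (max_jsr_ge0 _ PhiP) e0 M1 aM kn le_k.
Qed.

Lemma max_jsr_locally_lipschitz : (0 < n)%N ->
  locally_lipschitz_on
    [set Psi : set 'M[R]_n | compact_nonneg Psi /\ 0 < max_jsr Psi]
    (@hausdorff_dist R n) (@max_jsr R n).
Proof.
move=> n0 Z [ZP Z0]; have [M M1 HM] := max_jsr_perturb Z 1 n0 ZP.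
pose L := n%:R * M ^+ n; have M0 : 0 < M by lra.
have L0 : 0 < L by rewrite mulr_gt0 ?exprn_gt0// ltr0n.
(* Half the radius of [Z], capped at 1, serves as a lower bound for the radius on a whole ball
   around [Z]. *)
pose c : R := Num.min (max_jsr Z / 2) 1.
have c0 : 0 < c by rewrite lt_min ltr01 divr_gt0.
have cn0 : 0 < c ^+ n by rewrite exprn_gt0.
have c1 : c <= 1 by rewrite ge_min lexx orbT.
have c2 : 2 * c <= max_jsr Z.
  have : c <= max_jsr Z / 2 by rewrite ge_min lexx.
  lra.
have ZZ : hausdorff_dist Z Z < 1.
  by rewrite hausdorff_dist_refl.
have ge_c Psi : compact_nonneg Psi ->
    hausdorff_dist Z Psi < Num.min 1 (c ^+ n / L) -> c <= max_jsr Psi.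
  rewrite lt_min (ltr_pdivlMr _ _ L0) => PsiP /andP[rPsi ltPsi].
  have [_ [k kn le_k]] := HM _ _ ZP PsiP ZZ rPsi.
  apply: (le_of_expr_le _ _ _ _ _ _ (max_jsr_ge0 _ PsiP) c0 c1 c2 kn le_k).
  by rewrite mulrC.
(* Distance below 1 makes [M] valid; distance below [c ^+ n / L] makes the error smaller than
   [c ^+ n], so that [ge_c] applies. *)
exists (Num.min 1 (c ^+ n / L)), (L / c ^+ n); split.
- by rewrite lt_min ltr01 divr_gt0.
- by rewrite divr_ge0 ?ltW.
suff le_L Psi Phi : compact_nonneg Psi -> compact_nonneg Phi ->
    hausdorff_dist Z Psi < Num.min 1 (c ^+ n / L) ->
    hausdorff_dist Z Phi < Num.min 1 (c ^+ n / L) ->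
    max_jsr Psi - max_jsr Phi <= L / c ^+ n * hausdorff_dist Psi Phi.
  move=> Psi Phi [PsiP _] [PhiP _] rPsi rPhi; rewrite ler_norml le_L// andbT.
  by rewrite lerNl opprB hausdorff_distC le_L.
move=> PsiP PhiP rPsi rPhi; have cPsi := ge_c _ PsiP rPsi.
have H0 := hausdorff_dist_ge0 _ _ PsiP PhiP; have b0 := max_jsr_ge0 _ PhiP.
move: rPsi rPhi; rewrite !lt_min => /andP[rPsi _] /andP[rPhi _].
have [_ [k kn le_k]] := HM _ _ PsiP PhiP rPsi rPhi.
have x0 : 0 <= L * hausdorff_dist Psi Phi := mulr_ge0 (ltW L0) H0.
rewrite mulrAC.
exact: sub_le_of_expr_le_away0 b0 c0 c1 cPsi x0 kn le_k.
Qed.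

End Perturbation.

(** In (ii) the order is uniform but the constant depends on a ball. For [n = 2], the singletons of
    the matrices with rows (0, t), (0, 0) and (0, t), (s, 0) are at distance s, while their radii
    differ by the square root of s t, unbounded in t. *)
Theorem theorem5p3 (R : realType) (n : nat) (n_gt0 : (0 < n)%N) :
  locally_lipschitz_on
    [set Psi : set 'M[R]_n | compact_nonneg Psi /\ 0 < max_jsr Psi]
    (@hausdorff_dist R n) (@max_jsr R n) /\
  (exists alpha : R, 0 < alpha /\
    forall (Z : set 'M[R]_n) (r : R), compact_nonneg Z ->
      hoelder_on [set Psi : set 'M[R]_n |
                   compact_nonneg Psi /\ hausdorff_dist Z Psi < r]
        (@hausdorff_dist R n) (@max_jsr R n) alpha).
Proof.
split; first exact: max_jsr_locally_lipschitz.
exists n%:R^-1; split; first by rewrite invr_gt0 ltr0n.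
by move=> Z r ZP; exact: max_jsr_hoelder.
Qed.
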